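(* Let $n\ge 1$ and $0\le k\le n$ be integers. Then $$\begin{bmatrix} n\\ k\end{bmatrix}_{\mathcal{F}}=[F_{k+1}]_{q^{F_{n-k}}}\begin{bmatrix} n-1\\ k\end{bmatrix}_{\mathcal{F}}+q^{F_{n-k}F_{k+1}}\,[F_{n-1-k}]_{q^{F_{k}}}\begin{bmatrix} n-1\\ k-1\end{bmatrix}_{\mathcal{F}}.$$
   Context: Fibonacci numbers: $F_0=0$, $F_1=1$, $F_n=F_{n-1}+F_{n-2}$ (extended by the same recurrence, so that $F_{-1}=1$). For an integer $m\ge 0$, $[m]_q=\sum_{i=0}^{m-1}q^i$, with $q$ an indeterminate, and $[m]_{q^s}=\sum_{i=0}^{m-1}q^{si}$ for an integer $s\ge 0$ (so $[m]_{q^0}=m$). Put $[F_m]_q!=\prod_{i=1}^m [F_i]_q$ (with $[F_0]_q!=1$). The $q$-Fibonomial coefficient is, for integers $0\le k\le n$, $$\begin{bmatrix} n\\ k\end{bmatrix}_{\mathcal{F}}=\frac{[F_n]_q!}{[F_k]_q!\,[F_{n-k}]_q!},$$ and it is $0$ if $k<0$ or $k>n$. *)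

(* Defs.v *)
From HB Require Import structures.
From mathcomp Require Import all_boot all_order all_algebra.

Set Implicit Arguments.
Unset Strict Implicit.
Unset Printing Implicit Defensive.

Import Order.TTheory GRing.Theory Num.Theory.
Local Open Scope ring_scope.

Fixpoint fib_pos (m : nat) : int :=
  match m with
  | 0%N => 0
  | 1%N => 1
  | (p.+1 as p1).+1 => fib_pos p1 + fib_pos p
  end.

(* fib_neg m = F_(-m), from F_(-m-2) = F_(-m) - F_(-m-1) *)
Fixpoint fib_neg (m : nat) : int :=
  match m with
  | 0%N => 0
  | 1%N => 1
  | (p.+1 as p1).+1 => fib_neg p - fib_neg p1
  end.

Definition fib (m : int) : int :=
  match m with
  | Posz p => fib_pos p
  | Negz p => fib_neg p.+1
  end.

Lemma fib0 : fib 0 = 0. Proof. by []. Qed.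
Lemma fib1 : fib 1 = 1. Proof. by []. Qed.
Lemma fibN1 : fib (-1) = 1. Proof. by []. Qed.

Lemma fibE (m : int) : fib m = fib (m - 1) + fib (m - 2).
Proof.
case: m => [[|[|p]]|p] //.
- have -> : Posz p.+2 - 1 = Posz p.+1 by rewrite -[p.+2]addn1 PoszD addrK.
  by have -> : Posz p.+2 - 2 = Posz p by rewrite -[p.+2]addn2 PoszD addrK.
- have -> : Negz p - 1 = Negz p.+1 by rewrite !NegzE -opprD -PoszD addn1.
  have -> : Negz p - 2 = Negz p.+2 by rewrite !NegzE -opprD -PoszD addn2.
  by rewrite /= addrC subrK.
Qed.

(* Q(q), the field in which the quotients of q-factorials are taken *)
Notation ratfun := {fraction {poly rat}}.

Definition q : ratfun := tofrac 'X.

(* qint s m = [m]_{q^s}; only meaningful for 0 <= m, where `|m| = m *)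
Definition qint (s m : int) : ratfun := \sum_(0 <= i < `|m|) q ^ (s * i%:Z).

(* [F_m]_q! ; again only meaningful for 0 <= m *)
Definition qfibfact (m : int) : ratfun :=
  \prod_(1 <= i < `|m|.+1) qint 1 (fib i%:Z).

Definition qfibonomial (n k : int) : ratfun :=
  if 0 <= k <= n then qfibfact n / (qfibfact k * qfibfact (n - k)) else 0.

(* Main.v *)
(** Writing [n = k + m], the Fibonacci addition formula
    [F_n = F_m F_(k+1) + F_k F_(m-1)] lifts to
    [[F_n]_q = [F_m]_q [F_(k+1)]_(q^(F_m))
               + q^(F_m F_(k+1)) [F_k]_q [F_(m-1)]_(q^(F_k))]
    through [[a + b]_q = [a]_q + q^a [b]_q] and [[a b]_q = [a]_q [b]_(q^a)].
    For [0 < k < n] the recurrence is this identity multiplied by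
    [[F_(n-1)]_q! / ([F_k]_q! [F_m]_q!)]. *)
Require Import Defs.
From mathcomp Require Import all_boot all_order all_algebra.
From mathcomp Require Import ring zify.

Import Order.TTheory GRing.Theory Num.Theory.
Local Open Scope ring_scope.

(** Values in [nat], so that they can serve as summation bounds and as exponents of [^+]. *)
Definition fibn (m : nat) : nat := `|fib_pos m|%N.

Lemma fib_pos_ge0 (m : nat) : 0 <= fib_pos m.
Proof.
suff: (0 <= fib_pos m) && (0 <= fib_pos m.+1) by case/andP.
elim: m => [//|m /andP[h0 h1]]; rewrite h1 /=.
exact: addr_ge0 h1 h0.
Qed.

Lemma fib_posE (m : nat) : fib_pos m = (fibn m)%:Z.
Proof. by rewrite /fibn gez0_abs ?fib_pos_ge0. Qed.

Lemma fibnSS (m : nat) : fibn m.+2 = (fibn m.+1 + fibn m)%N.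
Proof. by apply/eqP; rewrite -eqz_nat PoszD -!fib_posE. Qed.

Lemma fibn_gt0 (m : nat) : (0 < fibn m.+1)%N.
Proof. by elim: m => [//|m IHm]; rewrite fibnSS ltn_addr. Qed.

(** Moving one unit from [k] to [m] leaves the right-hand side unchanged by the recurrence. Using
    [m.+1] avoids the index m - 1. *)
Lemma fibn_add (k m : nat) :
  fibn (k + m.+1) = (fibn m.+1 * fibn k.+1 + fibn k * fibn m)%N.
Proof.
elim: k m => [|k IHk] m; first by rewrite mul0n addn0 muln1.
rewrite addSnnS IHk !fibnSS; ring.
Qed.

Definition geom {K : comNzRingType} (x : K) (m : nat) : K := \sum_(0 <= i < m) x ^+ i.

Lemma geomD {K : comNzRingType} (x : K) (a b : nat) :
  geom x (a + b) = geom x a + x ^+ a * geom x b.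
Proof.
rewrite /geom (@big_cat_nat _ _ _ a) ?leq_addr //=; congr (_ + _).
rewrite -{1}[a]add0n big_addn addKn big_distrr /=.
by apply: eq_bigr => i _; rewrite addnC exprD.
Qed.

(** The exponents below [a * b] split into [b] blocks of length [a], block j contributing
    [x ^+ (a * j)] times the first; the induction adds the last block. *)
Lemma geomM {K : comNzRingType} (x : K) (a b : nat) :
  geom x (a * b) = geom x a * geom (x ^+ a) b.
Proof.
elim: b => [|b IHb]; first by rewrite muln0 /geom !big_nil mulr0.
rewrite mulnSr geomD IHb -addn1 geomD -exprM /geom big_nat1 expr0; ring.
Qed.

Lemma geom_fib_add {K : comNzRingType} (x : K) (k m : nat) :
  geom x (fibn (k + m.+1)) =
    geom x (fibn m.+1) * geom (x ^+ fibn m.+1) (fibn k.+1)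
    + x ^+ (fibn m.+1 * fibn k.+1)
      * (geom x (fibn k) * geom (x ^+ fibn k) (fibn m)).
Proof. by rewrite fibn_add geomD !geomM. Qed.

(** The underlying polynomial takes the value [m] at 1, which is nonzero in characteristic 0. *)
Lemma geom_q_neq0 (m : nat) : (0 < m)%N -> geom q m != 0.
Proof.
move=> m_gt0.
have -> : geom q m = tofrac (\sum_(0 <= i < m) 'X^i).
  by rewrite rmorph_sum; apply: eq_bigr => i _; rewrite rmorphXn.
rewrite tofrac_eq0; apply/eqP => /(congr1 (fun p : {poly rat} => p.[1])).
rewrite horner_sum horner0 (eq_bigr (fun=> 1)); last first.
  by move=> i _; rewrite hornerXn expr1n.
rewrite sumr_const_nat subn0 => /eqP.
by rewrite pnatr_eq0 eqn0Ngt m_gt0.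
Qed.

Lemma qintE (s m : nat) : qint s m = geom (q ^+ s) m.
Proof. by apply: eq_bigr => i _; rewrite -PoszM -exprM. Qed.

Lemma qfibfact0 : qfibfact 0 = 1.
Proof. by rewrite /qfibfact big_geq. Qed.

Lemma qfibfactS (m : nat) :
  qfibfact m.+1 = qfibfact m * geom q (fibn m.+1).
Proof.
rewrite /qfibfact big_nat_recr //; congr (_ * _).
by rewrite [fib _]fib_posE (qintE 1).
Qed.

Lemma qfibfact_neq0 (m : nat) : qfibfact m != 0.
Proof.
elim: m => [|m IHm]; first by rewrite qfibfact0 oner_neq0.
rewrite qfibfactS; apply: mulf_neq0 IHm _.
exact: geom_q_neq0 (fibn_gt0 m).
Qed.

Lemma qfibonomialE (k m : nat) :
  qfibonomial (k + m)%N k = qfibfact (k + m)%N / (qfibfact k * qfibfact m).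
Proof.
rewrite /qfibonomial lez_nat leq_addr /=.
by have -> : (k + m)%N%:Z - k%:Z = m by lia.
Qed.

Lemma qfibonomial_k0 (n : nat) : qfibonomial n 0 = 1.
Proof. by rewrite (qfibonomialE 0 n) qfibfact0 mul1r divff // qfibfact_neq0. Qed.

Lemma qfibonomial_diag (n : nat) : qfibonomial n n = 1.
Proof.
by rewrite -{1}[n]addn0 qfibonomialE qfibfact0 mulr1 addn0 divff // qfibfact_neq0.
Qed.

(** [a] and [b] stand for the last factors of the two lower factorials; each summand of the
    numerator cancels one of them. *)
Lemma pascal_split {K : fieldType} (N A B a b u v w : K) :
  A != 0 -> B != 0 -> a != 0 -> b != 0 ->
  N * (b * u + w * (a * v)) / (A * a * (B * b)) =
    u * (N / (A * a * B)) + w * v * (N / (A * (B * b))).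
Proof. by move=> A0 B0 a0 b0; field; apply/and4P. Qed.

Lemma qfibonomial_interior (k m : nat) :
  qfibonomial (k.+1 + m.+1)%N k.+1 =
    geom (q ^+ fibn m.+1) (fibn k.+2) * qfibonomial (k.+1 + m)%N k.+1
    + q ^+ (fibn m.+1 * fibn k.+2) * geom (q ^+ fibn k.+1) (fibn m)
      * qfibonomial (k + m.+1)%N k.
Proof.
(* Writing [k + m.+1] as [k.+1 + m] gives both coefficients on the right the same top factorial, the
   [N] of [pascal_split]. *)
rewrite !qfibonomialE -[(k + m.+1)%N]addSnnS addnS (qfibfactS (k.+1 + m)).
rewrite -addnS geom_fib_add (qfibfactS k) (qfibfactS m).
apply: pascal_split; [exact: qfibfact_neq0 | exact: qfibfact_neq0 | |].
  exact: geom_q_neq0 (fibn_gt0 k).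
exact: geom_q_neq0 (fibn_gt0 m).
Qed.

Theorem proposition3p3 (n k : int) (hn : 1 <= n) (hk : 0 <= k <= n) :
  qfibonomial n k =
    qint (fib (n - k)) (fib (k + 1)) * qfibonomial (n - 1) k
    + q ^ (fib (n - k) * fib (k + 1))
      * qint (fib k) (fib (n - 1 - k)) * qfibonomial (n - 1) (k - 1).
Proof.
case/andP: hk => k_ge0 le_kn.
have [k' ?] : exists k' : nat, k = k' by exists `|k|%N; rewrite gez0_abs.
have [m ?] : exists m : nat, n = (k' + m)%N by exists `|n - k'%:Z|%N; lia.
subst n k; have -> : (k' + m)%N%:Z - k'%:Z = m by lia.
have -> : k'%:Z + 1 = k'.+1 by lia.
case: k' m hn {k_ge0 le_kn} => [|k] m hn.
(* Case k = 0: the second coefficient has lower index -1, hence is 0 by default. *)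
- case: m hn => // m _.
  have -> : (0 + m.+1)%N%:Z - 1 = m by lia.
  rewrite !qfibonomial_k0 [fib m.+1]fib_posE fib1 (qintE _ 1) /geom big_nat1 expr0.
  by rewrite /qfibonomial /= mulr0 addr0 mulr1.
have -> : k.+1%:Z - 1 = k by lia.
case: m hn => [|m] _.
(* Case k = n: the first coefficient is 0 by default, and the second has factor 1 because F_0 = 0
   and F_(-1) = 1. *)
- rewrite addn0; have -> : k.+1%:Z - 1 = k by lia.
  have -> : k%:Z - k.+1%:Z = -1 by lia.
  rewrite !qfibonomial_diag fibN1 fib0 mul0r expr0z.
  rewrite [qfibonomial k k.+1]/qfibonomial lez_nat ltnn andbF mulr0 add0r.
  by rewrite [fib _]fib_posE (qintE _ 1) /geom big_nat1 expr0 !mulr1.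
have -> : (k.+1 + m.+1)%N%:Z - 1 - k.+1%:Z = m by lia.
have -> : (k.+1 + m.+1)%N%:Z - 1 = (k.+1 + m)%N by lia.
rewrite [fib m.+1]fib_posE [fib k.+2]fib_posE [fib k.+1]fib_posE [fib m]fib_posE.
by rewrite !qintE -PoszM qfibonomial_interior addSnnS.
Qed.
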